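(* Let $G$ be a finite group with pseudo-exponent $\alpha=\alpha(G)$, and let $\{d_i\}$ be the character degrees of $G$ (listed with multiplicity). Let $\omega$ be the exponent of matrix multiplication over $\mathbb{C}$. Then $$|G|^{\omega/\alpha}\le\sum_i d_i^{\omega}.$$
   Context: For a subset $S$ of a group, $Q(S)=\{s_1s_2^{-1}: s_1,s_2\in S\}$. A group $G$ realizes $\langle n_1,n_2,n_3\rangle$ if there are subsets $S_1,S_2,S_3\subseteq G$ with $|S_i|=n_i$ such that for all $q_i\in Q(S_i)$, if $q_1q_2q_3=1$ then $q_1=q_2=q_3=1$. The pseudo-exponent $\alpha(G)$ of a non-trivial finite group $G$ is the minimum of $\frac{3\log|G|}{\log nmp}$ over all positive integers $n,m,p$ (not all $1$) such that $G$ realizes $\langle n,m,p\rangle$; the pseudo-exponent of the trivial group is $3$. The character degrees of $G$ are the dimensions of its irreducible complex representations, one for each isomorphism class; equivalently, the numbers $d_i$ in $\mathbb{C}[G]\cong\prod_i\mathbb{C}^{d_i\times d_i}$. The exponent $\omega$ is the smallest real number such that for each $\varepsilon>0$, two $n\times n$ complex matrices can be multiplied using $O(n^{\omega+\varepsilon})$ arithmetic operations (equivalently, the tensor rank of $n\times n$ matrix multiplication over $\mathbb{C}$ is $O(n^{\omega+\varepsilon})$ for each $\varepsilon>0$). *)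

(* Defs.v *)
From HB Require Import structures.
From mathcomp Require Import all_boot all_order all_algebra all_fingroup.
From mathcomp Require Import mxrepresentation.
From mathcomp Require Import all_classical all_reals all_analysis.
From mathcomp Require Import complex.

Set Implicit Arguments.
Unset Strict Implicit.
Unset Printing Implicit Defensive.

Import Order.TTheory GRing.Theory Num.Theory.
Import numFieldNormedType.Exports.

Local Open Scope classical_set_scope.
Local Open Scope ring_scope.

Section PseudoExponent.
Variable gT : finGroupType.
Implicit Types (G : {group gT}) (S : {set gT}).

Definition quotient_set S : {set gT} := [set (x * y^-1)%g | x in S, y in S]%SET.

Definition realizes G (n m p : nat) : Prop :=
  exists S1 S2 S3 : {set gT},
    [/\ S1 \subset G, S2 \subset G & S3 \subset G] /\
    [/\ #|S1| = n, #|S2| = m & #|S3| = p] /\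
    forall q1 q2 q3 : gT,
      q1 \in quotient_set S1 -> q2 \in quotient_set S2 ->
      q3 \in quotient_set S3 ->
      (q1 * q2 * q3 = 1)%g -> [/\ q1 = 1%g, q2 = 1%g & q3 = 1%g].

(* Realized triples have entries at most #|G|, so for G nontrivial this set is
   finite (and contains the value 3 of the triple (#|G|, 1, 1)); its infimum is
   therefore a minimum. *)
Definition pseudo_exponent (R : realType) G : R :=
  if (G == 1 :> {set gT})%g then 3
  else inf [set a : R | exists n m p : nat,
    [/\ [/\ (0 < n)%N, (0 < m)%N & (0 < p)%N],
        ~ [/\ n = 1%N, m = 1%N & p = 1%N],
        realizes G n m p
      & a = 3 * ln (#|G|%:R) / ln ((n * m * p)%N%:R)]].

End PseudoExponent.

Section TensorRank.
Variables (F : fieldType) (I J K : finType).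

(* A tensor in F^I (x) F^J (x) F^K is given by its coordinates. *)
Definition is_sum_of_simple (t : I -> J -> K -> F) (r : nat) : Prop :=
  exists (u : 'I_r -> I -> F) (v : 'I_r -> J -> F) (w : 'I_r -> K -> F),
    forall i j k, t i j k = \sum_(l < r) u l i * v l j * w l k.

Lemma is_sum_of_simple_exists (t : I -> J -> K -> F) :
  exists r, `[< is_sum_of_simple t r >].
Proof.
exists #|{: I * J * K}|; apply/asboolP.
exists (fun l i => t (enum_val l).1.1 (enum_val l).1.2 (enum_val l).2
                   * (i == (enum_val l).1.1)%:R).
exists (fun l j => (j == (enum_val l).1.2)%:R).
exists (fun l k => (k == (enum_val l).2)%:R) => i j k.
rewrite (bigD1 (enum_rank (i, j, k))) //= enum_rankK /= !eqxx !mulr1.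
rewrite big1 ?addr0 // => l; apply: contraNeq => nz.
rewrite -(enum_valK l); apply/eqP; congr enum_rank; move: nz.
case: (enum_val l) => -[i' j'] k' /=.
case: (eqVneq i i') => [->|_]; last by rewrite mulr0 !mul0r eqxx.
case: (eqVneq j j') => [->|_]; last by rewrite mulr0 mul0r eqxx.
by case: (eqVneq k k') => [->|_] //; rewrite mulr0 eqxx.
Qed.

Definition tensor_rank (t : I -> J -> K -> F) : nat :=
  ex_minn (is_sum_of_simple_exists t).

End TensorRank.

(* The tensor \sum_(i, j, k) e_ij (x) e_jk (x) e_ki of the multiplication of
   n x m by m x p matrices. *)
Definition matmul_tensor (F : fieldType) (n m p : nat)
    (a : 'I_n * 'I_m) (b : 'I_m * 'I_p) (c : 'I_p * 'I_n) : F :=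
  [&& a.2 == b.1, b.2 == c.1 & c.2 == a.1]%:R.

Definition matmul_rank (F : fieldType) (n : nat) : nat :=
  tensor_rank (@matmul_tensor F n n n).

(* The conditions "O(n ^ (w + e)) for every e > 0" define a half-line that is
   closed below and bounded below, so the infimum is its smallest element. *)
Definition matmul_exponent (R : realType) : R :=
  inf [set w : R | forall e : R, 0 < e ->
    (fun n : nat => (matmul_rank R[i] n)%:R : R^o) =O_\oo
    (fun n : nat => n%:R `^ (w + e) : R^o)].

(* Indexes the isomorphism classes of irreducible complex representations of G:
   over R[i] each of them occurs in the regular representation. *)
Definition complex_irr (R : realType) (gT : finGroupType) (G : {group gT}) :
    irrType R[i] G :=
  DecSocleType (regular_repr R[i] G).

(* Main.v *)
(* If G realizes <n, m, p>, the triple product property embeds the matrix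
   multiplication tensor <n, m, p> into the structure tensor of C[G], which
   Fourier inversion writes as a direct sum of the tensors <d_i, d_i, d_i>.
   Taking l-th tensor powers and bounding the rank of each summand by
   C (d_{i_1} ... d_{i_l})^(omega + e) gives
   rank <n^l, m^l, p^l> <= C (sum_i d_i^(omega + e))^l.  Conversely the product
   of the three rotations of <n, m, p> is <nmp, nmp, nmp>, and N^omega is at
   most the rank of <N, N, N>; hence (nmp)^(l omega) <= rank <n^l, m^l, p^l> ^ 3.
   Letting l go to infinity and then e to 0 yields
   (nmp)^(omega / 3) <= sum_i d_i^omega. *)
Require Import Defs.
From mathcomp Require Import all_boot all_order all_algebra all_fingroup.
From mathcomp Require Import mxrepresentation.
From mathcomp Require Import all_classical all_reals all_analysis.
From mathcomp Require Import complex.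
From mathcomp Require Import lra pgroup character.

Set Implicit Arguments.
Unset Strict Implicit.
Unset Printing Implicit Defensive.

Import Order.TTheory GRing.Theory Num.Theory.
Import numFieldNormedType.Exports.

Local Open Scope classical_set_scope.
Local Open Scope ring_scope.

(** * Tensor rank under restriction, rotation, product and sum; matrix multiplication tensors *)

Section TensorRankTheory.
Variable F : fieldType.

Lemma is_sum_of_simple_index (I J K L : finType) (t : I -> J -> K -> F)
    (u : L -> I -> F) (v : L -> J -> F) (w : L -> K -> F) :
  (forall i j k, t i j k = \sum_l u l i * v l j * w l k) ->
  is_sum_of_simple t #|L|.
Proof.
move=> tE; exists (u \o enum_val), (v \o enum_val), (w \o enum_val) => i j k.
by rewrite tE (reindex (@enum_val L predT)) //; apply: onW_bij; apply: enum_val_bij.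
Qed.

Lemma tensor_rankP (I J K : finType) (t : I -> J -> K -> F) :
  is_sum_of_simple t (tensor_rank t).
Proof. by rewrite /tensor_rank; case: ex_minnP => r /asboolP. Qed.

Lemma tensor_rank_le (I J K : finType) (t : I -> J -> K -> F) r :
  is_sum_of_simple t r -> (tensor_rank t <= r)%N.
Proof.
by move=> tr; rewrite /tensor_rank; case: ex_minnP => s _; apply; apply/asboolP.
Qed.

(** Each pair [(i, j)] contributes one simple tensor: the two unit vectors at [i] and [j] times the
    slice [t i j]. For [n] by [n] matrix multiplication this gives the crude bound [n ^ 4]. *)
Lemma tensor_rank_le_card (I J K : finType) (t : I -> J -> K -> F) :
  (tensor_rank t <= #|I| * #|J|)%N.
Proof.
rewrite -card_prod; apply: tensor_rank_le.
apply: (is_sum_of_simple_index (u := fun l i => (i == l.1)%:R)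
  (v := fun l j => (j == l.2)%:R) (w := fun l k => t l.1 l.2 k)) => i j k.
rewrite (bigD1 (i, j)) //= !eqxx !mul1r big1 ?addr0 // => -[i' j'] /=.
rewrite xpair_eqE negb_and !(eq_sym _ i) (eq_sym _ j).
by case/orP=> /negPf->; rewrite ?mulr0 !mul0r.
Qed.

Lemma tensor_rank_gt0 (I J K : finType) (t : I -> J -> K -> F) i j k :
  t i j k != 0 -> (0 < tensor_rank t)%N.
Proof.
have := tensor_rankP t; case: tensor_rank => // -[u [v [w ->]]].
by rewrite big_ord0 eqxx.
Qed.

(** A decomposition pulls back along arbitrary index maps, so this serves both for restriction to a
    subtensor and for renaming of indices. *)
Lemma tensor_rank_reindex (I J K I' J' K' : finType) (t : I -> J -> K -> F)
    (t' : I' -> J' -> K' -> F) (f : I' -> I) (g : J' -> J) (h : K' -> K) :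
  (forall i j k, t' i j k = t (f i) (g j) (h k)) ->
  (tensor_rank t' <= tensor_rank t)%N.
Proof.
move=> t'E; apply: tensor_rank_le; have [u [v [w tE]]] := tensor_rankP t.
exists (fun l => u l \o f), (fun l => v l \o g), (fun l => w l \o h) => i j k.
by rewrite t'E tE.
Qed.

Lemma tensor_rank_rot (I J K : finType) (t : I -> J -> K -> F) :
  (tensor_rank (fun j k i => t i j k) <= tensor_rank t)%N.
Proof.
apply: tensor_rank_le; have [u [v [w tE]]] := tensor_rankP t.
by exists v, w, u => j k i; rewrite tE; apply: eq_bigr => l _; rewrite -mulrA mulrC.
Qed.

Lemma tensor_rankM (I J K I' J' K' : finType) (t : I -> J -> K -> F)
    (t' : I' -> J' -> K' -> F) :
  (tensor_rank (fun (i : I * I') (j : J * J') (k : K * K') =>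
                  (t i.1 j.1 k.1 * t' i.2 j.2 k.2)%R)
   <= tensor_rank t * tensor_rank t')%N.
Proof.
have [u [v [w tE]]] := tensor_rankP t; have [u' [v' [w' t'E]]] := tensor_rankP t'.
apply: tensor_rank_le; rewrite -(card_ord (tensor_rank t)) -(card_ord (tensor_rank t')).
rewrite -card_prod.
apply: (@is_sum_of_simple_index _ _ _ _ _
  (fun l i => u l.1 i.1 * u' l.2 i.2) (fun l j => v l.1 j.1 * v' l.2 j.2)
  (fun l k => w l.1 k.1 * w' l.2 k.2)) => i j k.
rewrite tE t'E big_distrlr /= pair_bigA /=; apply: eq_bigr => l _.
by rewrite mulrACA (mulrACA (u _ _)).
Qed.

Lemma is_sum_of_simpleD (I J K : finType) (t t' : I -> J -> K -> F) r r' :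
  is_sum_of_simple t r -> is_sum_of_simple t' r' ->
  is_sum_of_simple (fun i j k => t i j k + t' i j k) (r + r').
Proof.
move=> [u [v [w tE]]] [u' [v' [w' t'E]]].
pose glue T (x : 'I_r -> T) (x' : 'I_r' -> T) l :=
  match fintype.split l with inl l => x l | inr l => x' l end.
exists (glue _ u u'), (glue _ v v'), (glue _ w w') => i j k.
rewrite big_split_ord /= tE t'E; congr (_ + _); apply: eq_bigr => l _.
  by rewrite /glue -[lshift _ l]/(unsplit (inl l)) unsplitK.
by rewrite /glue -[rshift _ l]/(unsplit (inr l)) unsplitK.
Qed.

Notation mmrank n m p := (tensor_rank (@matmul_tensor F n m p)).

Lemma mmrank_gt0 n m p : (0 < n)%N -> (0 < m)%N -> (0 < p)%N -> (0 < mmrank n m p)%N.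
Proof.
case: n m p => [|n] [|m] [|p] // _ _ _.
apply: (@tensor_rank_gt0 _ _ _ _ (ord0, ord0) (ord0, ord0) (ord0, ord0)).
by rewrite /matmul_tensor !eqxx oner_eq0.
Qed.

Lemma leq_mmrank n m p n' m' p' : (n <= n')%N -> (m <= m')%N -> (p <= p')%N ->
  (mmrank n m p <= mmrank n' m' p')%N.
Proof.
move=> ln lm lp; pose wn := widen_ord ln; pose wm := widen_ord lm.
pose wp := widen_ord lp.
by apply: (@tensor_rank_reindex _ _ _ _ _ _ _ _ (fun a => (wn a.1, wm a.2))
  (fun b => (wm b.1, wp b.2)) (fun c => (wp c.1, wn c.2))).
Qed.

Lemma mmrank_rot n m p : (mmrank m p n <= mmrank n m p)%N.
Proof.
apply: leq_trans (tensor_rank_rot _).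
apply: (@tensor_rank_reindex _ _ _ _ _ _ _ _ id id id) => a b c.
by rewrite /matmul_tensor; congr (nat_of_bool _)%:R; rewrite andbA andbC.
Qed.

Lemma card_ord_prod n m : #|{: 'I_n * 'I_m}| = (n * m)%N.
Proof. by rewrite card_prod !card_ord. Qed.

Definition ord_unpair n m (i : 'I_(n * m)) : 'I_n * 'I_m :=
  enum_val (cast_ord (esym (card_ord_prod n m)) i).

Lemma ord_unpair_inj n m : injective (@ord_unpair n m).
Proof. by move=> i j /enum_val_inj /cast_ord_inj. Qed.

(** Splits a position in a block matrix into the position of the block and the position inside the
    block. *)
Definition ord_unpair2 n m n' m' (a : 'I_(n * n') * 'I_(m * m')) :
    ('I_n * 'I_m) * ('I_n' * 'I_m') :=
  (((ord_unpair a.1).1, (ord_unpair a.2).1), ((ord_unpair a.1).2, (ord_unpair a.2).2)).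

Lemma matmul_tensorM n m p n' m' p' a b c :
  @matmul_tensor F (n * n') (m * m') (p * p') a b c =
  matmul_tensor F (ord_unpair2 a).1 (ord_unpair2 b).1 (ord_unpair2 c).1 *
  matmul_tensor F (ord_unpair2 a).2 (ord_unpair2 b).2 (ord_unpair2 c).2.
Proof.
rewrite /matmul_tensor -natrM mulnb /=; congr (nat_of_bool _)%:R.
have E k l (i j : 'I_(k * l)) :
    (i == j) = ((ord_unpair i).1 == (ord_unpair j).1) &&
               ((ord_unpair i).2 == (ord_unpair j).2).
  by rewrite -(inj_eq (@ord_unpair_inj _ _)); case: (ord_unpair i) (ord_unpair j) => ? ? [].
by rewrite !E -!andbA; do !bool_congr.
Qed.

Lemma mmrankM n m p n' m' p' :
  (mmrank (n * n') (m * m') (p * p') <= mmrank n m p * mmrank n' m' p')%N.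
Proof.
apply: leq_trans (tensor_rankM _ _).
exact: (tensor_rank_reindex (@matmul_tensorM n m p n' m' p')).
Qed.

Lemma matmul_rank_le_cube n m p : (matmul_rank F (n * m * p) <= mmrank n m p ^ 3)%N.
Proof.
(* The three sizes are equal numbers but different terms; monotonicity in the sizes takes the place
   of a cast. *)
have le_rot : (matmul_rank F (n * m * p) <= mmrank (n * m * p) (m * p * n) (p * n * m))%N.
  by apply: leq_mmrank => //; apply: eq_leq; [rewrite -mulnA mulnC | rewrite mulnC mulnA].
apply: leq_trans le_rot _.
apply: leq_trans (mmrankM _ _ _ _ _ _) _; rewrite !expnSr expn0 mul1n.
apply: leq_mul (leq_trans (mmrank_rot _ _ _) (mmrank_rot _ _ _)).
by apply: leq_trans (mmrankM _ _ _ _ _ _) (leq_mul _ (mmrank_rot _ _ _)).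
Qed.

Lemma matmul_rankX n k : (matmul_rank F (n ^ k) <= matmul_rank F n ^ k)%N.
Proof.
elim: k => [|k IHk]; last first.
  by rewrite !expnS (leq_trans (mmrankM _ _ _ _ _ _)) ?leq_mul2l ?IHk ?orbT.
apply: tensor_rank_le; exists (fun _ _ => 1), (fun _ _ => 1), (fun _ _ => 1) => a b c.
rewrite big_ord1 !mulr1 /matmul_tensor.
by case: a b c => a1 a2 [b1 b2] [c1 c2]; rewrite !ord1 /= ?eqxx.
Qed.

End TensorRankTheory.

(** This replaces the limit over tensor powers: after taking logarithms, a multiplicative constant
    becomes the fixed [c], and the power becomes the factor [k]. *)
Lemma le0_of_bounded_multiples (R : archiRealFieldType) (x c : R) :
  (forall k : nat, k%:R * x <= c) -> x <= 0.
Proof.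
move=> xc; rewrite leNgt; apply/negP => x0.
have c0 : 0 <= c by rewrite -(mul0r x); apply: xc 0%N.
have /archi_boundP : 0 <= c / x by rewrite divr_ge0 // ltW.
by rewrite ltr_pdivrMr // ltNge xc.
Qed.

(** * The exponent of matrix multiplication as a bound on ranks from both sides *)

Section MatmulExponent.
Variable R : realType.
Implicit Types (n k : nat) (e w : R).

Local Notation rank n := (matmul_rank R[i] n).
Local Notation omega := (matmul_exponent R).

Let exponents : set R := [set w : R | forall e : R, 0 < e ->
  (fun n : nat => (rank n)%:R : R^o) =O_\oo (fun n : nat => n%:R `^ (w + e) : R^o)].

Lemma matmul_rank_gt0 n : (0 < n)%N -> (0 < rank n)%N.
Proof. by move=> n0; apply: mmrank_gt0. Qed.

Lemma powR_nat_ge1 n w : (0 < n)%N -> 0 <= w -> 1 <= (n%:R : R) `^ w.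
Proof. by move=> n0 w0; rewrite -[leLHS](powRr0 n%:R) ler_powR // ler1n. Qed.

Lemma exponents_bound w C :
  0 <= C -> (forall n, (0 < n)%N -> (rank n)%:R <= C * n%:R `^ w) -> exponents w.
Proof.
move=> C0 rC e e0; apply/eqO_exP; exists (C + 1); first by rewrite ltr_wpDl.
near=> n; have n0 : (0 < n)%N by near: n; exact: nbhs_infty_ge.
rewrite !ger0_norm ?powR_ge0 //; apply: le_trans (rC n n0) _.
by apply: ler_pM; rewrite ?powR_ge0 // ?lerDl // ler_powR ?ler1n // lerDl ltW.
Unshelve. all: by end_near. Qed.

(** The asymptotic bound holds from some [N] on; the finitely many smaller sizes are absorbed by
    adding to the constant the sum [D] of their ratios. *)
Lemma exponents_rank_bound w e : exponents w -> 0 < e ->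
  exists2 C : R, 0 < C & forall n, (0 < n)%N -> (rank n)%:R <= C * n%:R `^ (w + e).
Proof.
move=> /[apply] /eqO_exP[C C0 [N _ CN]].
pose D : R := \sum_(n < N) (rank n)%:R / n%:R `^ (w + e).
have D0 : 0 <= D by apply: sumr_ge0 => i _; rewrite divr_ge0 ?powR_ge0.
exists (C + D) => [|n n0]; first by rewrite ltr_wpDr.
have pn : 0 < (n%:R : R) `^ (w + e) by rewrite powR_gt0 // ltr0n.
have [ltnN|leNn] := ltnP n N.
  rewrite -ler_pdivrMr // /D (bigD1 (Ordinal ltnN)) //= addrCA lerDl addr_ge0 ?(ltW C0) //.
  by apply: sumr_ge0 => i _; rewrite divr_ge0 ?powR_ge0.
have := CN n leNn; rewrite /= !ger0_norm ?powR_ge0 // => /le_trans; apply.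
by rewrite ler_pM2r // lerDl.
Qed.

(** Ranks are at least 1, whereas a negative exponent would force them to 0 along the powers of 2.
    The choice [e = - w / 2] keeps [w + e] negative. *)
Lemma exponents_ge0 w : exponents w -> 0 <= w.
Proof.
move=> Ww; rewrite leNgt; apply/negP => w0.
have [|C C0 rC] := @exponents_rank_bound w (- w / 2) Ww; first by rewrite divr_gt0 ?oppr_gt0.
have : - w / 2 * ln 2 <= 0.
  apply: (@le0_of_bounded_multiples _ _ (ln C)) => k.
  have := rC (2 ^ k)%N; rewrite expn_gt0 => /(_ isT) r2.
  have : 1 <= C * (2 ^ k)%:R `^ (w + - w / 2).
    by apply: le_trans r2; rewrite ler1n matmul_rank_gt0 ?expn_gt0.
  have pk : 0 < (2 ^ k)%:R :> R by rewrite ltr0n expn_gt0.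
  rewrite -ler_ln ?posrE ?mulr_gt0 ?powR_gt0 // ln1.
  rewrite lnM ?posrE ?powR_gt0 // ln_powR natrX lnXn //.
  by rewrite mulrnAl -mulrnAr -[_ *+ k]mulr_natr; lra.
by apply/negP; rewrite -ltNge !mulr_gt0 ?oppr_gt0 ?ln_gt0 ?ltr1n // invr_gt0.
Qed.

Lemma exponents_nonempty : exponents !=set0.
Proof.
exists 4; apply: (@exponents_bound 4 1) => // n n0.
rewrite mul1r powR_mulrn // -natrX ler_nat; apply: leq_trans (tensor_rank_le_card _) _.
by rewrite !card_ord_prod (expnM n 2 2) -!mulnn.
Qed.

Lemma has_inf_exponents : has_inf exponents.
Proof. by split; [exact: exponents_nonempty | exists 0 => w; exact: exponents_ge0]. Qed.

Lemma matmul_exponent_ge0 : 0 <= omega.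
Proof. by apply: lb_le_inf exponents_nonempty _ => w; exact: exponents_ge0. Qed.

Lemma matmul_rank_bound e : 0 < e ->
  exists2 C : R, 0 < C & forall n, (0 < n)%N -> (rank n)%:R <= C * n%:R `^ (omega + e).
Proof.
move=> e0; have e20 : 0 < e / 2 by rewrite divr_gt0.
(* One half of [e] pays for approximating the infimum by [w], the other half for the slack in the
   definition of [exponents]. *)
have [w Ww /ltW le_w] := inf_adherent e20 has_inf_exponents.
have [C C0 rC] := exponents_rank_bound Ww e20; exists C => // n n0.
apply: le_trans (rC n n0) _; rewrite ler_wpM2l ?(ltW C0) // ler_powR ?ler1n //.
by have: w <= omega + e / 2 by []; lra.
Qed.

(** The number [w] with [n ^ w = rank n] is an admissible exponent: if [n ^ k <= N < n ^ k.+1], then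
    [rank N <= rank n ^ k.+1 = rank n * (n ^ k) ^ w <= rank n * N ^ w]. The case [n = 1] is separate
    since [ln 1 = 0]. *)
Lemma powR_omega_le_rank n : (0 < n)%N -> n%:R `^ omega <= (rank n)%:R :> R.
Proof.
move=> n0; have r0 := matmul_rank_gt0 n0.
have [n1|n_gt1] := leqP n 1.
  have -> : n = 1%N by apply/eqP; rewrite eqn_leq n1.
  by rewrite powR1 ler1n matmul_rank_gt0.
have lnn : 0 < ln n%:R :> R by rewrite ln_gt0 // ltr1n.
pose w : R := ln (rank n)%:R / ln n%:R.
have w0 : 0 <= w by rewrite divr_ge0 ?(ltW lnn) // ln_ge0 // ler1n.
have nw : n%:R `^ w = (rank n)%:R :> R.
  by rewrite /powR pnatr_eq0 (gtn_eqF n0) divfK ?gt_eqF // lnK // posrE ltr0n.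
rewrite -nw ler_powR ?ler1n //; apply: ge_inf; first exact: has_inf_exponents.2.
apply: (@exponents_bound _ (rank n)%:R) => // N N0.
have /andP[leN ltN] := trunc_log_bounds n_gt1 N0; set k := trunc_log n N in leN ltN.
have leX : (rank N <= rank n * rank n ^ k)%N.
  by rewrite -expnS (leq_trans _ (matmul_rankX _ _ _)) // leq_mmrank // ltnW.
apply: le_trans (_ : (rank n * rank n ^ k)%:R <= _); first by rewrite ler_nat.
rewrite natrM ler_wpM2l // natrX -nw -powR_mulrn ?powR_ge0 // powRAC powR_mulrn //.
by rewrite -natrX ge0_ler_powR // ?nnegrE // ler_nat.
Qed.

End MatmulExponent.

(** * Restrictions of direct sums of matrix multiplication tensors *)

Section MatmulSum.
Variable F : fieldType.

(* [t] is a restriction of the direct sum over [x] of the tensors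
   <d x, d x, d x>: a matrix multiplication tensor, contracted with three
   families of matrices, is the trace of their product. *)
Definition matmul_sum (X : finType) (d : X -> nat) (I J K : Type)
    (t : I -> J -> K -> F) : Prop :=
  exists (A : forall x, I -> 'M[F]_(d x)) (B : forall x, J -> 'M[F]_(d x))
         (C : forall x, K -> 'M[F]_(d x)),
    forall i j k, t i j k = \sum_x \tr (A x i *m B x j *m C x k).

Lemma matmul_sum_reindex (X : finType) (d : X -> nat) (I J K I' J' K' : Type)
    (t : I -> J -> K -> F) (t' : I' -> J' -> K' -> F)
    (f : I' -> I) (g : J' -> J) (h : K' -> K) :
  (forall i j k, t' i j k = t (f i) (g j) (h k)) ->
  matmul_sum d t -> matmul_sum d t'.
Proof.
move=> t'E [A [B [C tE]]].
exists (fun x => A x \o f), (fun x => B x \o g), (fun x => C x \o h).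
by move=> i j k; rewrite t'E tE.
Qed.

(** Kronecker products of the matrix families work, because they respect matrix products and the
    trace is multiplicative on them. *)
Lemma matmul_sumM (X X' : finType) (d : X -> nat) (d' : X' -> nat)
    (I J K I' J' K' : Type) (t : I -> J -> K -> F) (t' : I' -> J' -> K' -> F) :
  matmul_sum d t -> matmul_sum d' t' ->
  matmul_sum (fun x : X * X' => (d x.1 * d' x.2)%N)
    (fun (i : I * I') (j : J * J') (k : K * K') => t i.1 j.1 k.1 * t' i.2 j.2 k.2).
Proof.
move=> [A [B [C tE]]] [A' [B' [C' t'E]]].
exists (fun x i => tprod (A x.1 i.1) (A' x.2 i.2)),
  (fun x j => tprod (B x.1 j.1) (B' x.2 j.2)),
  (fun x k => tprod (C x.1 k.1) (C' x.2 k.2)) => i j k.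
rewrite tE t'E big_distrlr /= pair_bigA /=; apply: eq_bigr => x _.
by rewrite -!tprodE mxtrace_prod.
Qed.

(** The index type [Y] consists of nested pairs, in effect [l]-tuples over [X], and [e] multiplies
    the sizes along the tuple; hence the sum of [w]-th powers is multiplicative. *)
Lemma matmul_sumX (X : finType) (d : X -> nat) n m p l :
  matmul_sum d (@matmul_tensor F n m p) ->
  exists (Y : finType) (e : Y -> nat),
    [/\ matmul_sum e (@matmul_tensor F (n ^ l) (m ^ l) (p ^ l)),
        (forall x, 0 < d x)%N -> forall y, (0 < e y)%N &
        forall (R : realType) (w : R),
          \sum_y (e y)%:R `^ w = (\sum_x (d x)%:R `^ w) ^+ l].
Proof.
move=> dT; elim: l => [|l [Y [e [eT e0 eE]]]].
  exists unit, (fun=> 1%N); split=> // [|R w].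
    exists (fun _ _ => 1%:M), (fun _ _ => 1%:M), (fun _ _ => 1%:M) => a b c.
    rewrite big_const card_unit /= addr0 !mulmx1 mxtrace1 /matmul_tensor.
    by case: a b c => a1 a2 [b1 b2] [c1 c2]; rewrite !ord1 /= ?eqxx.
  by rewrite big_const card_unit /= addr0 powR1.
exists (X * Y)%type, (fun x => d x.1 * e x.2)%N; split=> [|d0 x|R w].
- rewrite !expnS.
  exact: matmul_sum_reindex (@matmul_tensorM F _ _ _ _ _ _) (matmul_sumM dT eT).
- by rewrite muln_gt0 d0 e0.
rewrite exprS -eE big_distrlr /= pair_bigA /=; apply: eq_bigr => x _.
by rewrite natrM powRM.
Qed.

Lemma mxtrace_mul3 n (A B C : 'M[F]_n) :
  \tr (A *m B *m C) =
  \sum_a \sum_b \sum_c matmul_tensor F a b c * (A a.1 a.2 * B b.1 b.2 * C c.1 c.2).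
Proof.
have sum_pair (f : 'I_n * 'I_n -> F) : \sum_a f a = \sum_i \sum_j f (i, j).
  by rewrite pair_bigA; apply: eq_bigr => -[].
rewrite [RHS]sum_pair.
apply: eq_bigr => i _; rewrite mxE.
under eq_bigr => k _ do rewrite mxE big_distrl /=.
rewrite exchange_big /=; apply: eq_bigr => j _.
rewrite [RHS]sum_pair [RHS](bigD1 j) //= [X in _ + X]big1 ?addr0 => [|j' /negPf nj]; last first.
  by apply: big1 => k _; apply: big1 => c _; rewrite /matmul_tensor /= eq_sym nj mul0r.
apply: eq_bigr => k _; rewrite (bigD1 (k, i)) //= {1}/matmul_tensor /= !eqxx mul1r.
rewrite big1 ?addr0 // => -[k' i']; rewrite xpair_eqE /matmul_tensor /= eqxx (eq_sym k).
by move/negPf->; rewrite mul0r.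
Qed.

(** The trace is the multiplication tensor contracted with the matrix entries, so each simple term
    of an optimal decomposition contracts to a simple term. *)
Lemma is_sum_of_simple_mxtrace n (I J K : finType)
    (A : I -> 'M[F]_n) (B : J -> 'M[F]_n) (C : K -> 'M[F]_n) :
  is_sum_of_simple (fun i j k => \tr (A i *m B j *m C k)) (matmul_rank F n).
Proof.
have [u [v [w uvw]]] := tensor_rankP (@matmul_tensor F n n n).
exists (fun l i => \sum_a u l a * A i a.1 a.2), (fun l j => \sum_b v l b * B j b.1 b.2),
  (fun l k => \sum_c w l c * C k c.1 c.2) => i j k.
rewrite mxtrace_mul3; under [RHS]eq_bigr => l _ do rewrite big_distrlr /= big_distrl /=.
rewrite [RHS]exchange_big /=; apply: eq_bigr => a _.
under [RHS]eq_bigr => l _ do rewrite big_distrlr /=.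
rewrite [RHS]exchange_big /=; apply: eq_bigr => b _.
rewrite [RHS]exchange_big /=; apply: eq_bigr => c _.
rewrite uvw big_distrl /=; apply: eq_bigr => l _.
by rewrite (mulrACA (u l a)) (mulrACA (u l a * v l b)).
Qed.

Lemma tensor_rank_matmul_sum (X : finType) (d : X -> nat) (I J K : finType)
    (t : I -> J -> K -> F) :
  matmul_sum d t -> (tensor_rank t <= \sum_x matmul_rank F (d x))%N.
Proof.
move=> [A [B [C tE]]]; apply: tensor_rank_le.
(* With the sum in explicit form, induction on the list of indices becomes possible. *)
suff: is_sum_of_simple (fun i j k => \sum_x \tr (A x i *m B x j *m C x k))
    (\sum_x matmul_rank F (d x)).
  by move=> [u [v [w E]]]; exists u, v, w => i j k; rewrite tE E.
elim: (index_enum X) => [|x r IHr].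
  rewrite big_nil; exists (fun _ _ => 0), (fun _ _ => 0), (fun _ _ => 0) => i j k.
  by rewrite big_nil big_ord0.
rewrite big_cons.
have [u [v [w E]]] := is_sum_of_simpleD (is_sum_of_simple_mxtrace (A x) (B x) (C x)) IHr.
by exists u, v, w => i j k; rewrite big_cons E.
Qed.

End MatmulSum.

(** * Fourier inversion and the triple product property *)

Section GroupTensor.
Variables (F : closedFieldType) (gT : finGroupType) (G : {group gT}).
Variable sG : irrType F G.
Hypothesis charF : [pchar F] =i pred0.

(** A diagonal entry at [g] is nonzero only if [g * x = g], that is, [x = 1]. *)
Lemma mxtrace_regular_repr x : x \in G ->
  \tr (regular_repr F G x) = #|G|%:R * (x == 1%g)%:R.
Proof.
move=> Gx; rewrite /mxtrace.
under eq_bigr => i _.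
  rewrite !mxE eqxx /= -(inj_eq (can_inj gring_valK)) gring_indexK ?groupM ?enum_valP //.
  rewrite -{1}[enum_val i]mulg1 (inj_eq (mulgI _)) eq_sym.
over.
by rewrite sumr_const card_ord mulr_natl.
Qed.

(** The regular representation contains each irreducible one as often as its degree; comparing
    traces and dividing by [#|G|] gives the formula. *)
Lemma regular_char_decomp x : x \in G ->
  (x == 1%g)%:R = \sum_(i : sG) (irr_degree i)%:R / #|G|%:R * \tr (irr_repr i x).
Proof.
move=> Gx; have G0 : #|G|%:R != 0 :> F by rewrite (pcharf0P F).1 // -lt0n cardG_gt0.
apply: (mulfI G0); rewrite -mxtrace_regular_repr //.
rewrite (mxtrace_regular_pchar sG) //; last first.
- exact: group_closure_closed_field.
- by apply/pgroupP => q _ _; rewrite inE /= charF.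
rewrite big_distrr /=; apply: eq_bigr => i _.
by rewrite mulrA mulrCA divff // mulr1 mulr_natl.
Qed.

(** Send an index pair [(s, t)] to [s^-1 * t]. By the triple product property, the product of three
    such elements is 1 exactly when the adjacent indices agree, and the indicator of 1 expands into
    irreducible traces. The weights are put into the first family. *)
Lemma realizes_matmul_sum n m p : realizes G n m p ->
  matmul_sum (fun i : sG => irr_degree i) (@matmul_tensor F n m p).
Proof.
move=> [S1 [S2 [S3 [[sG1 sG2 sG3] [[<- <- <-] tpp]]]]].
move: sG1 sG2 sG3 => /fintype.subsetP sG1 /fintype.subsetP sG2 /fintype.subsetP sG3.
pose q (S T : {set gT}) (a : 'I_#|S| * 'I_#|T|) := ((enum_val a.1)^-1 * enum_val a.2)%g.
exists (fun i a => ((irr_degree i)%:R / #|G|%:R) *: irr_repr i (q _ _ a)),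
  (fun i b => irr_repr i (q _ _ b)), (fun i c => irr_repr i (q _ _ c)) => a b c.
have Gq (S T : {set gT}) (x : 'I_#|S| * 'I_#|T|) :
    {subset S <= G} -> {subset T <= G} -> q _ _ x \in G.
  by move=> SG TG; rewrite /q groupM ?groupV //; [apply: SG | apply: TG]; apply: enum_valP.
have Ga := Gq _ _ a sG1 sG2; have Gb := Gq _ _ b sG2 sG3; have Gc := Gq _ _ c sG3 sG1.
have Gab := groupM Ga Gb.
under eq_bigr => i _.
  rewrite -!scalemxAl mxtraceZ -(repr_mxM _ Ga Gb) -(repr_mxM _ Gab Gc).
over.
rewrite -regular_char_decomp ?(groupM Gab Gc) // /matmul_tensor; congr (nat_of_bool _)%:R.
move: Ga Gb Gc Gab => _ _ _ _; case: a b c => [s t] [t' u] [u' s']; rewrite /q /=.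
apply/and3P/eqP => [[/eqP-> /eqP-> /eqP->]|E].
  by rewrite !mulgA !mulgK mulVg.
have [] := tpp (enum_val s' * (enum_val s)^-1)%g
  (enum_val t * (enum_val t')^-1)%g (enum_val u * (enum_val u')^-1)%g.
- by apply: imset2_f; exact: enum_valP.
- by apply: imset2_f; exact: enum_valP.
- by apply: imset2_f; exact: enum_valP.
(* Conjugation moves the last factor [s'] to the front, which leaves a product of one quotient from
   each of the three sets. *)
- move: E => /(congr1 (fun x => x ^ (enum_val s')^-1)%g).
  by rewrite conj1g /conjg invgK !mulgA mulgK.
have quo1 (S : {set gT}) (x y : 'I_#|S|) : (enum_val x * (enum_val y)^-1 = 1)%g -> x = y.
  by move/eqP; rewrite -eq_mulgV1 => /eqP/enum_val_inj.
by move=> /quo1-> /quo1-> /quo1->.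
Qed.

End GroupTensor.

(** * The bound for a single realized triple *)

Section GroupBound.
Variables (R : realType) (gT : finGroupType) (G : {group gT}).

Local Notation omega := (matmul_exponent R).
Local Notation degree_sum w := (\sum_(i : complex_irr R G) (irr_degree i)%:R `^ w : R).

Lemma degree_sum_ge1 w : 0 <= w -> 1 <= degree_sum w.
Proof.
move=> w0; rewrite (bigD1 (principal_comp (complex_irr R G))) //=.
by rewrite ler_wpDr ?sumr_ge0 ?powR_nat_ge1 ?irr_degree_gt0 // => i _; rewrite powR_ge0.
Qed.

Lemma realizes_le_degree_sum_eps n m p e : (0 < n)%N -> (0 < m)%N -> (0 < p)%N -> 0 < e ->
  realizes G n m p -> omega * ln (n * m * p)%:R <= 3 * ln (degree_sum (omega + e)).
Proof.
move=> n0 m0 p0 e0 Gnmp; set S := degree_sum _.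
have w0 : 0 <= omega + e by rewrite addr_ge0 ?matmul_exponent_ge0 ?ltW.
have S0 : 0 < S by apply: lt_le_trans (degree_sum_ge1 w0).
have N0 : (0 < n * m * p)%N by rewrite !muln_gt0 n0 m0.
have [C C0 rC] := matmul_rank_bound e0.
rewrite -subr_le0; apply: (@le0_of_bounded_multiples _ _ (3 * ln C)) => l.
have [Y [d [dT d0 dE]]] := matmul_sumX l
  (realizes_matmul_sum (complex_irr R G) (@pchar_num R[i]) Gnmp).
have rk_le : (tensor_rank (@matmul_tensor R[i] (n ^ l) (m ^ l) (p ^ l)))%:R <= C * S ^+ l.
  apply: le_trans (_ : (\sum_y matmul_rank R[i] (d y))%:R <= _).
    by rewrite ler_nat tensor_rank_matmul_sum.
  rewrite natr_sum -dE mulr_sumr; apply: ler_sum => y _.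
  by apply/rC/d0 => i; exact: irr_degree_gt0.
(* The cube comes from the three rotations; it turns into the factor 3 under the logarithm. *)
have : ((n * m * p) ^ l)%:R `^ omega <= (C * S ^+ l) ^+ 3.
  apply: le_trans (powR_omega_le_rank _ _) _; first by rewrite expn_gt0 N0.
  apply: le_trans (_ : (tensor_rank (@matmul_tensor R[i] (n ^ l) (m ^ l) (p ^ l)))%:R ^+ 3 <= _).
    by rewrite -natrX ler_nat !expnMn matmul_rank_le_cube.
  by rewrite lerXn2r // nnegrE ?ler0n // (le_trans _ rk_le) // ler0n.
have X0 : 0 < ((n * m * p) ^ l)%:R :> R by rewrite ltr0n expn_gt0 N0.
have Sl0 : 0 < S ^+ l by rewrite exprn_gt0.
rewrite -ler_ln ?posrE ?powR_gt0 ?exprn_gt0 ?mulr_gt0 //.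
rewrite ln_powR natrX !lnXn ?mulr_gt0 ?ltr0n //.
rewrite lnM ?posrE // lnXn // => le_ln.
have : omega * (l%:R * ln (n * m * p)%:R) <= 3 * (ln C + l%:R * ln S).
  by rewrite !mulr_natl.
lra.
Qed.

Lemma realizes_le_degree_sum n m p : (0 < n)%N -> (0 < m)%N -> (0 < p)%N ->
  realizes G n m p -> omega * ln (n * m * p)%:R <= 3 * ln (degree_sum omega).
Proof.
move=> n0 m0 p0 Gnmp; set S := degree_sum _.
have w0 := matmul_exponent_ge0 R.
have S0 : 0 < S by apply: lt_le_trans (degree_sum_ge1 w0).
pose D : R := (\sum_(i : complex_irr R G) irr_degree i)%:R.
have leD (i : complex_irr R G) : (irr_degree i)%:R <= D.
  by rewrite ler_nat (bigD1 i) //= leq_addr.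
have D1 : 1 <= D.
  by apply: le_trans (leD (principal_comp _)); rewrite ler1n irr_degree_gt0.
have D0 : 0 < D by apply: lt_le_trans D1.
have lnD : 0 <= ln D by rewrite ln_ge0.
(* As [D] bounds every degree, raising the exponent by [e'] costs at most the factor [D ^ e'], so
   [3 * (e' * ln D) <= e] is wanted. The summand 1 keeps the denominator positive when [D = 1]. *)
apply/ler_addgt0Pr => e e0; pose e' := e / (3 * ln D + 1).
have e'0 : 0 < e' by rewrite divr_gt0 // ltr_wpDl // mulr_ge0.
have le_S : ln (degree_sum (omega + e')) <= e' * ln D + ln S.
  have Se : 0 < degree_sum (omega + e').
    by apply: lt_le_trans (degree_sum_ge1 _); rewrite // addr_ge0 // ltW.
  rewrite -ln_powR -lnM ?posrE ?powR_gt0 // ler_ln ?posrE ?mulr_gt0 ?powR_gt0 //.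
  rewrite mulr_sumr; apply: ler_sum => i _.
  rewrite addrC powRD ?pnatr_eq0 ?(gtn_eqF (irr_degree_gt0 i)) ?implybT //.
  by rewrite ler_wpM2r ?powR_ge0 // ge0_ler_powR ?nnegrE ?ler0n ?(ltW D0) ?(ltW e'0).
have := realizes_le_degree_sum_eps n0 m0 p0 e'0 Gnmp.
have : 3 * (e' * ln D) <= e.
  by rewrite mulrCA /e' mulrAC ler_pdivrMr ?ler_wpM2l ?lerDl ?(ltW e0) // ltr_wpDl // mulr_ge0.
lra.
Qed.

End GroupBound.

(** * From realized triples to the infimum *)

Theorem theorem4p1 (R : realType) (gT : finGroupType) (G : {group gT}) :
  (#|G|%:R : R) `^ (matmul_exponent R / pseudo_exponent R G) <=
  \sum_(i : complex_irr R G) (irr_degree i)%:R `^ matmul_exponent R.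
Proof.
set S := \sum_i _; have w0 := matmul_exponent_ge0 R.
have S1 : 1 <= S by exact: degree_sum_ge1.
have S0 : 0 < S by apply: lt_le_trans S1.
rewrite /pseudo_exponent; case: eqP => [->|_]; first by rewrite cards1 powR1.
set E := [set a | _]%classic.
have G0 : 0 < #|G|%:R :> R by rewrite ltr0n cardG_gt0.
have lnG : 0 <= ln #|G|%:R :> R by rewrite ln_ge0 // ler1n cardG_gt0.
have E_bound a : E a -> 0 <= a /\ matmul_exponent R * ln #|G|%:R <= a * ln S.
  move=> [n [m [p [[n0 m0 p0] ne1 Gnmp ->]]]].
  have N1 : (1 < n * m * p)%N.
    rewrite ltn_neqAle eq_sym !muln_gt0 n0 m0 p0 !andbT !muln_eq1.
    by apply/negP => /andP[/andP[/eqP n1 /eqP m1] /eqP p1]; apply: ne1.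
  have lnN : 0 < ln (n * m * p)%:R :> R by rewrite ln_gt0 // ltr1n.
  split; first by rewrite divr_ge0 ?mulr_ge0 // ltW.
  have := realizes_le_degree_sum R n0 m0 p0 Gnmp; rewrite -/S.
  rewrite mulrAC ler_pdivlMr // => /(ler_wpM2r lnG); lra.
have a0 : 0 <= inf E.
  have [->|/set0P E0] := eqVneq E set0; first by rewrite inf0.
  by apply: lb_le_inf => // a /E_bound[].
(* Division by 0 yields 0, so here the left side is 1. Since the infimum of the empty set is 0 by
   default, [E] is nonempty in what remains. *)
have [->|a_neq0] := eqVneq (inf E) 0; first by rewrite invr0 mulr0 powRr0.
have a_gt0 : 0 < inf E by rewrite lt_neqAle eq_sym a_neq0.
have E0 : (E !=set0)%classic.
  by apply/set0P; apply: contra_neq a_neq0 => ->; rewrite inf0.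
rewrite -ler_ln ?posrE ?powR_gt0 // ln_powR mulrAC ler_pdivrMr //.
(* If [ln S] is positive, dividing [E_bound] by it gives a lower bound of [E], hence of its infimum.
   Otherwise [ln S = 0], and any single element of [E] gives the claim. *)
have [lnS0|lnS0] := ltP 0 (ln S).
  rewrite -ler_pdivrMl //; apply: lb_le_inf => // a /E_bound[_].
  by rewrite ler_pdivrMl // (mulrC (ln S)).
have lnS_eq0 : ln S = 0 by apply/eqP; rewrite eq_le lnS0 ln_ge0.
by case: E0 => a /E_bound[_]; rewrite lnS_eq0 mulr0 mul0r.
Qed.
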